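(* Any element $\rho\in\hat{\mathbb{Z}}^*$ determines an isomorphism between the $C^*$-algebra $C^*_{\mathcal{Z}}(\widehat{\mathbb{Z}[q]})$ and the abelian part $C^*(\mathbb{Q}/\mathbb{Z})$ of the Bost--Connes algebra.
   Context: $\mathbb{N}$ is the set of positive integers and $\mathcal{Z}$ the set of all roots of unity in $\mathbb{C}$. The Habiro ring is $\widehat{\mathbb{Z}[q]}=\varprojlim_n\mathbb{Z}[q]/((q)_n)$, $(q)_n=(1-q)\cdots(1-q^n)$; for $\zeta\in\mathcal{Z}$, $\mathrm{ev}_\zeta:\widehat{\mathbb{Z}[q]}\to\mathbb{Z}[\zeta]$ is the ring homomorphism induced by $q\mapsto\zeta$. $C^*_{\mathcal{Z}}(\widehat{\mathbb{Z}[q]})$ is the abelian $C^*$-algebra generated by all the operators $E_{\zeta,f}\in\mathcal{B}(\ell^2(\mathbb{N}))$, for $\zeta\in\mathcal{Z}$ and $f\in\widehat{\mathbb{Z}[q]}$, where $E_{\zeta,f}\,\epsilon_n=\mathrm{ev}_{\zeta^n}(f)\,\epsilon_n$ on the canonical basis $\{\epsilon_n\}_{n\in\mathbb{N}}$ of $\ell^2(\mathbb{N})$. $C^*(\mathbb{Q}/\mathbb{Z})$ is the group $C^*$-algebra of $\mathbb{Q}/\mathbb{Z}$, with generators $e(r)$, $r\in\mathbb{Q}/\mathbb{Z}$. An element $\rho\in\hat{\mathbb{Z}}^*=\mathrm{Aut}(\mathbb{Q}/\mathbb{Z})$ is viewed as a choice of an embedding $r\mapsto\rho(r)$ of the abstract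 roots of unity $\mathbb{Q}/\mathbb{Z}$ in $\mathbb{C}^*$ (with image $\mathcal{Z}$). *)

(* Defs.v *)
From HB Require Import structures.
From mathcomp Require Import all_boot all_order all_algebra complex.
From mathcomp Require Import all_classical all_reals all_analysis.
From mathcomp Require Import ring lra.

Set Implicit Arguments.
Unset Strict Implicit.
Unset Printing Implicit Defensive.

Import Order.TTheory GRing.Theory Num.Theory numFieldNormedType.Exports.
Import ComplexField.Normc.

Local Open Scope classical_set_scope.
Local Open Scope ring_scope.
Local Open Scope quotient_scope.

(* The norm is given by hand because the library has no structure joining
   GRing.Algebra with NormedModule, and none can be added downstream. *)
HB.mixin Record isCstarAlgebra (R : realType) A of GRing.Algebra R[i] A := {
  cnorm : A -> R;
  star : A -> A;
  cnorm0_eq0 : forall x : A, cnorm x = 0 -> x = 0;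
  cnormD_le : forall x y : A, cnorm (x + y) <= cnorm x + cnorm y;
  cnormZ : forall (a : R[i]) (x : A), cnorm (a *: x) = normc a * cnorm x;
  cnormM_le : forall x y : A, cnorm (x * y) <= cnorm x * cnorm y;
  cnorm_complete : forall u : nat -> A,
    (forall eps : R, 0 < eps -> exists N : nat, forall m n : nat,
      (N <= m)%N -> (N <= n)%N -> cnorm (u m - u n) < eps) ->
    exists l : A, cnorm (u n - l) @[n --> \oo] --> (0 : R);
  starK : involutive star;
  starD : {morph star : x y / x + y};
  starZ : forall (a : R[i]) (x : A), star (a *: x) = a^*%C *: star x;
  starM : forall x y : A, star (x * y) = star y * star x;
  cnorm_starM : forall x : A, cnorm (star x * x) = cnorm x ^+ 2
}.

#[short(type="cstarAlgType")]
HB.structure Definition CstarAlgebra (R : realType) :=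
  {A of isCstarAlgebra R A & GRing.Algebra R[i] A}.

Section CstarTheory.
Variable R : realType.

Record cstar_subalgebra (A : cstarAlgType R) (S : set A) : Prop := {
  csub_lin : forall (a : R[i]) (x y : A), S x -> S y -> S (a *: x + y);
  csub_mul : forall x y : A, S x -> S y -> S (x * y);
  csub_star : forall x : A, S x -> S (star x);
  csub_closed : forall (u : nat -> A) (l : A), (forall n, S (u n)) ->
    cnorm (u n - l) @[n --> \oo] --> (0 : R) -> S l }.

Definition cstar_generated (A : cstarAlgType R) (G : set A) : set A :=
  smallest (@cstar_subalgebra A) G.

Record star_morphism (A B : cstarAlgType R) (f : A -> B) : Prop := {
  starm_linear : linear f;
  starm_mul : monoid_morphism f;
  starm_star : {morph f : x / star x} }.

(* The three clauses make each u g a unitary with inverse u (- g). *)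
Record unitary_rep (G : zmodType) (A : cstarAlgType R) (u : G -> A) : Prop := {
  urep0 : u 0 = 1;
  urepD : forall g h : G, u (g + h) = u g * u h;
  urepN : forall g : G, u (- g) = star (u g) }.

(* The full group C*-algebra of a discrete abelian group G with its canonical
   generators e(g): the universal unital C*-algebra generated by unitaries
   subject to the relations of G.  This determines (A, e) up to a unique
   *-isomorphism. *)
Record is_group_cstar (G : zmodType) (A : cstarAlgType R) (e : G -> A) :
  Prop := {
  gcstar_rep : unitary_rep e;
  gcstar_gen : cstar_generated (range e) = setT;
  gcstar_univ : forall (B : cstarAlgType R) (u : G -> B), unitary_rep u ->
    exists! f : A -> B, star_morphism f /\ forall g, f (e g) = u g }.

End CstarTheory.

(* Throughout, n : nat stands for the positive integer n.+1. *)
Section Ell2.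
Variable R : realType.

Definition square_summable (x : nat -> R[i]) : bool :=
  `[< cvgn (series (fun n => normc (x n) ^+ 2 : R)) >].

Lemma square_summable_le (x y : nat -> R[i]) :
  (forall n, normc (y n) ^+ 2 <= normc (x n) ^+ 2) ->
  square_summable x -> square_summable y.
Proof.
move=> le_yx /asboolP cx; apply/asboolP.
apply: (series_le_cvg _ _ le_yx cx) => n; exact: sqr_ge0.
Qed.

Lemma square_summableZ (a : R[i]) (x : nat -> R[i]) :
  square_summable x -> square_summable (fun n => a * x n).
Proof.
move=> /asboolP cx; apply/asboolP.
rewrite (_ : (fun n => _) =
  (normc a ^+ 2 *: (fun n => normc (x n) ^+ 2 : R))).
  exact: is_cvg_seriesZ.
by apply/funext => n; rewrite normcM exprMn.
Qed.

Lemma square_summableD (x y : nat -> R[i]) :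
  square_summable x -> square_summable y ->
  square_summable (fun n => x n + y n).
Proof.
move=> /asboolP cx /asboolP cy; apply/asboolP.
pose u := 2 *: ((fun n => normc (x n) ^+ 2 : R) \+
                (fun n => normc (y n) ^+ 2 : R)).
apply: (@series_le_cvg _ _ u).
- by move=> n; exact: sqr_ge0.
- by move=> n; rewrite /u mulr_ge0// addr_ge0// sqr_ge0.
- move=> n.
  have := le_normcD (x n) (y n).
  have n0 (z : R[i]) : 0 <= normc z by case: z => a b; exact: sqrtr_ge0.
  move: (n0 (x n)) (n0 (y n)) (n0 (x n + y n)); rewrite /u /GRing.scale/=.
  move: (normc _) (normc _) (normc _) => a b c a0 b0 c0 cab.
  apply: (@le_trans _ _ ((c + b) ^+ 2)).
    by rewrite ler_pXn2r ?nnegrE ?addr_ge0.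
  rewrite -subr_ge0 (_ : _ - _ = (c - b) ^+ 2) ?sqr_ge0//.
  by rewrite (_ : 2 *: _ = 2 * (c ^+ 2 + b ^+ 2))//; ring.
- rewrite /u; apply: is_cvg_seriesZ.
  by rewrite (_ : series _ = series (fun n => normc (x n) ^+ 2 : R) +
    series (fun n => normc (y n) ^+ 2 : R)) ?seriesD//; exact: is_cvgD.
Qed.

Definition ell2_pred : {pred nat -> R[i]} := square_summable.

Lemma ell2_submod_closed : submod_closed ell2_pred.
Proof.
split=> [|a x y sx sy].
  rewrite unfold_in; apply/asboolP.
  rewrite (_ : series _ = cst 0); first exact: is_cvg_cst.
  apply/funext => n; rewrite /series/= big1// => i _.
  by rewrite expr0n addr0 sqrtr0 expr0n.
exact: (square_summableD (square_summableZ a sx) sy).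
Qed.

HB.instance Definition _ := GRing.isSubmodClosed.Build _ _ ell2_pred
  ell2_submod_closed.

Record ell2 := Ell2 { ell2_val :> nat -> R[i]; _ : ell2_pred ell2_val }.

HB.instance Definition _ := [isSub for ell2_val].
HB.instance Definition _ := [Choice of ell2 by <:].
HB.instance Definition _ := [SubChoice_isSubLmodule of ell2 by <:].

Definition ell2_norm (x : ell2) : R :=
  Num.sqrt (limn (series (fun n => normc (x n) ^+ 2 : R))).

Definition ell2_dot (x y : ell2) : R[i] :=
  limn (series (fun n => x n * (y n)^*%C : R[i]^o)).

Definition eps_seq (k n : nat) : R[i] := (n == k)%:R.

Lemma eps_seq_ell2 k : ell2_pred (eps_seq k).
Proof.
apply/asboolP; apply: (@is_cvg_near_cst nat R (1 : R)); exists k.+1 => // n kn.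
rewrite /series/= (bigD1_seq k) ?iota_uniq ?mem_index_iota//= /eps_seq.
rewrite eqxx normc1 expr1n big1 ?addr0// => i /negbTE ->.
by rewrite normc0 expr0n.
Qed.

Definition ell2_eps (k : nat) : ell2 := Ell2 (eps_seq_ell2 k).

(* Diagonal operators; the default value 0 is only reached when c x is not
   square summable, which does not happen for bounded c. *)
Definition diag_op (c : nat -> R[i]) (x : ell2) : ell2 :=
  insubd 0 (fun n => c n * x n).

Lemma diag_op_eps c k : diag_op c (ell2_eps k) = c k *: ell2_eps k.
Proof.
rewrite /diag_op (_ : (fun n => _) = val (c k *: ell2_eps k)) ?valKd//.
apply/funext => n; rewrite [RHS](_ : _ = c k * eps_seq k n)//=.
by rewrite /eps_seq; case: eqP => [->//|_]; rewrite !mulr0.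
Qed.

Lemma diag_opE c (x : ell2) (M : R) n :
  (forall m, normc (c m) <= M) -> diag_op c x n = c n * x n.
Proof.
move=> cM.
have n0 (z : R[i]) : 0 <= normc z by case: z => a b; exact: sqrtr_ge0.
have M0 : 0 <= M := le_trans (n0 _) (cM 0%N).
suff cx : ell2_pred (fun m => c m * x m) by rewrite /diag_op /insubd insubT.
apply: (@square_summable_le (fun m => M%:C%C * x m)); last first.
  by apply: square_summableZ; case: x.
move=> m; rewrite !normcM !exprMn ler_wpM2r ?sqr_ge0// ler_pXn2r ?nnegrE ?n0//.
by apply: le_trans (cM m) _; rewrite /= expr0n addr0 sqrtr_sqr ler_norm.
Qed.

Definition bounded_op (T : ell2 -> ell2) : Prop :=
  linear T /\ exists M : R, forall x, ell2_norm (T x) <= M * ell2_norm x.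

Definition is_adjoint (T T' : ell2 -> ell2) : Prop :=
  forall x y, ell2_dot (T x) y = ell2_dot x (T' y).

Definition op_cvg (T : nat -> ell2 -> ell2) (L : ell2 -> ell2) : Prop :=
  forall eps : R, 0 < eps -> exists N : nat, forall n : nat, (N <= n)%N ->
    forall x, ell2_norm (T n x - L x) <= eps * ell2_norm x.

Record op_cstar_subalgebra (S : set (ell2 -> ell2)) : Prop := {
  opsub_bounded : S `<=` bounded_op;
  opsub_lin : forall (a : R[i]) T1 T2, S T1 -> S T2 ->
    S (fun x => a *: T1 x + T2 x);
  opsub_comp : forall T1 T2, S T1 -> S T2 -> S (T1 \o T2);
  opsub_adjoint : forall T T', S T -> bounded_op T' -> is_adjoint T T' -> S T';
  opsub_closed : forall (T : nat -> ell2 -> ell2) L, (forall n, S (T n)) ->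
    bounded_op L -> op_cvg T L -> S L }.

Definition op_cstar_generated (G : set (ell2 -> ell2)) : set (ell2 -> ell2) :=
  smallest op_cstar_subalgebra G.

(* Bijective *-homomorphisms from A to a C*-algebra S of operators. *)
Record star_iso_onto (A : cstarAlgType R) (S : set (ell2 -> ell2))
    (phi : A -> ell2 -> ell2) : Prop := {
  siso_lin : forall (a : R[i]) (x y : A) (v : ell2),
    phi (a *: x + y) v = a *: phi x v + phi y v;
  siso_mul : forall x y : A, phi (x * y) = phi x \o phi y;
  siso_star : forall x : A, is_adjoint (phi x) (phi (star x));
  siso_inj : injective phi;
  siso_range : range phi = S }.

End Ell2.

Arguments ell2_eps {R} k.

Definition qpoch (n : nat) : {poly int} := \prod_(1 <= k < n.+1) (1 - 'X^k).

(* The ideal ((q)_n.+1).  The level (q)_0 = 1 is left out: its quotient is the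
   zero ring, so it does not affect the limit. *)
Definition qpoch_ideal (n : nat) (p : {poly int}) : bool :=
  `[< exists h : {poly int}, p = h * qpoch n.+1 >].

Lemma qpoch_ideal_closed n : idealr_closed (qpoch_ideal n).
Proof.
split.
- by apply/asboolP; exists 0; rewrite mul0r.
- apply/asboolP => -[h] /(congr1 (fun p => p.[1])).
  have q0 : (1 - 'X^1 : {poly int}).[1] = 0.
    by rewrite hornerD hornerN hornerXn hornerC expr1n subrr.
  rewrite hornerM /qpoch big_nat_recl// hornerM q0 mul0r mulr0 hornerC.
  by move=> /eqP; rewrite oner_eq0.
- move=> a p r /asboolP[h ->] /asboolP[g ->]; apply/asboolP.
  by exists (a * h + g); rewrite mulrDl mulrA.
Qed.

HB.instance Definition _ n := isIdealr.Build {poly int} (qpoch_ideal n)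
  (qpoch_ideal_closed n).

Definition habiro_level (n : nat) := {ideal_quot (qpoch_ideal n : idealr {poly int})}.
HB.instance Definition _ n := GRing.ComNzRing.on (habiro_level n).

Definition habiro_proj n (x : habiro_level n.+1) : habiro_level n :=
  \pi_(habiro_level n) (repr x).

Lemma qpoch_ideal_le m n p : (m <= n)%N -> p \in qpoch_ideal n ->
  p \in qpoch_ideal m.
Proof.
move=> mn /asboolP[h ->]; apply/asboolP.
exists (h * \prod_(m.+2 <= k < n.+2) (1 - 'X^k)).
by rewrite -mulrA; congr (_ * _); rewrite mulrC -big_cat_nat.
Qed.

Lemma habiro_level_eq n (p r : {poly int}) :
  (\pi_(habiro_level n) p = \pi_(habiro_level n) r) <->
  p - r \in qpoch_ideal n.
Proof.
split=> [/eqP|h]; first by rewrite -Quotient.idealrBE.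
by apply/eqP; rewrite -Quotient.idealrBE.
Qed.

Lemma habiro_projE n p :
  habiro_proj (\pi_(habiro_level n.+1) p) = \pi_(habiro_level n) p.
Proof.
apply/habiro_level_eq/(qpoch_ideal_le (leqnSn n))/habiro_level_eq.
by rewrite reprK.
Qed.

Record habiro := Habiro {
  habiro_seq :> forall n, habiro_level n;
  habiro_coherent : forall n, habiro_proj (habiro_seq n.+1) = habiro_seq n }.

Lemma habiro_eq (f g : habiro) : (forall n, f n = g n) -> f = g.
Proof.
case: f g => f cf [g cg] /= fg.
have {}fg : f = g by exact: functional_extensionality_dep.
by case: _ / fg cg => cg; congr Habiro; exact: Prop_irrelevance.
Qed.

Definition habiro_poly (p : {poly int}) : habiro :=
  @Habiro (fun n => \pi_(habiro_level n) p) (fun n => habiro_projE n p).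

Definition habiro_q : habiro := habiro_poly 'X.

Section HabiroRing.
Implicit Types f g h : habiro.

Lemma habiro_proj_add n : {morph @habiro_proj n : x y / x + y}.
Proof.
move=> x y; rewrite -[x]reprK -[y]reprK -rmorphD !habiro_projE.
by rewrite rmorphD.
Qed.

Lemma habiro_proj_opp n : {morph @habiro_proj n : x / - x}.
Proof. by move=> x; rewrite -[x]reprK -rmorphN !habiro_projE rmorphN. Qed.

Lemma habiro_proj_mul n : {morph @habiro_proj n : x y / x * y}.
Proof.
move=> x y; rewrite -[x]reprK -[y]reprK -rmorphM !habiro_projE.
by rewrite rmorphM.
Qed.

Fact habiro_add_coherent f g n :
  habiro_proj (f n.+1 + g n.+1) = f n + g n.
Proof.
rewrite -[in RHS](habiro_coherent f n) -[in RHS](habiro_coherent g n).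
exact: habiro_proj_add.
Qed.

Fact habiro_opp_coherent f n : habiro_proj (- f n.+1) = - f n.
Proof.
by rewrite -[in RHS](habiro_coherent f n); exact: habiro_proj_opp.
Qed.

Fact habiro_mul_coherent f g n :
  habiro_proj (f n.+1 * g n.+1) = f n * g n.
Proof.
rewrite -[in RHS](habiro_coherent f n) -[in RHS](habiro_coherent g n).
exact: habiro_proj_mul.
Qed.

Definition habiro_add f g := @Habiro (fun n => f n + g n) (habiro_add_coherent f g).
Definition habiro_opp f := @Habiro (fun n => - f n) (habiro_opp_coherent f).
Definition habiro_mul f g := @Habiro (fun n => f n * g n) (habiro_mul_coherent f g).

HB.instance Definition _ := gen_eqMixin habiro.
HB.instance Definition _ := gen_choiceMixin habiro.

Fact habiro_addA : associative habiro_add.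
Proof. by move=> f g h; apply: habiro_eq => n /=; rewrite addrA. Qed.
Fact habiro_addC : commutative habiro_add.
Proof. by move=> f g; apply: habiro_eq => n /=; rewrite addrC. Qed.
Fact habiro_add0 : left_id (habiro_poly 0) habiro_add.
Proof. by move=> f; apply: habiro_eq => n /=; rewrite rmorph0 add0r. Qed.
Fact habiro_addN : left_inverse (habiro_poly 0) habiro_opp habiro_add.
Proof. by move=> f; apply: habiro_eq => n /=; rewrite rmorph0 addNr. Qed.

HB.instance Definition _ := GRing.isZmodule.Build habiro
  habiro_addA habiro_addC habiro_add0 habiro_addN.

Fact habiro_mulA : associative habiro_mul.
Proof. by move=> f g h; apply: habiro_eq => n /=; rewrite mulrA. Qed.
Fact habiro_mulC : commutative habiro_mul.
Proof. by move=> f g; apply: habiro_eq => n /=; rewrite mulrC. Qed.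
Fact habiro_mul1 : left_id (habiro_poly 1) habiro_mul.
Proof. by move=> f; apply: habiro_eq => n /=; rewrite rmorph1 mul1r. Qed.
Fact habiro_mulD : left_distributive habiro_mul habiro_add.
Proof. by move=> f g h; apply: habiro_eq => n /=; rewrite mulrDl. Qed.
Fact habiro_1neq0 : habiro_poly 1 != 0.
Proof.
apply/eqP => /(congr1 (fun f : habiro => f 0%N))/= /eqP.
by rewrite rmorph0 rmorph1 oner_eq0.
Qed.

HB.instance Definition _ := GRing.Zmodule_isComNzRing.Build habiro
  habiro_mulA habiro_mulC habiro_mul1 habiro_mulD habiro_1neq0.

Lemma habiro_repr (f : habiro) m n : (m <= n)%N ->
  f m = \pi_(habiro_level m) (repr (f n)).
Proof.
move=> /subnKC <-; elim: (n - m)%N => [|k IH]; first by rewrite addn0 reprK.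
rewrite {}IH addnS; apply/habiro_level_eq.
apply: (qpoch_ideal_le (leq_addr k m)); apply/habiro_level_eq.
by rewrite reprK -habiro_coherent -{1}[f _]reprK habiro_projE.
Qed.

End HabiroRing.

Section Evaluation.
Variable R : realType.

Definition root_of_unity (z : R[i]) : Prop :=
  exists2 n : nat, (0 < n)%N & n.-unity_root z.

(* (q)_k.+1 vanishes at z as soon as z ^+ k.+1 = 1, so that reduction modulo
   (q)_k.+1 determines the value at z; see habiro_evE.  The value is
   meaningless when z is not a root of unity. *)
Definition habiro_ev (z : R[i]) (f : habiro) : R[i] :=
  let k := xget 0%N [set k | z ^+ k.+1 = 1] in
  (map_poly intr (repr (f k))).[z].

Lemma qpoch_ideal_root (z : R[i]) n m p : z ^+ m.+1 = 1 -> (m <= n)%N ->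
  p \in qpoch_ideal n -> (map_poly intr p).[z] = 0.
Proof.
move=> zm mn /(qpoch_ideal_le mn)/asboolP[h ->].
have q0 : (map_poly intr (1 - 'X^(m.+1) : {poly int})).[z] = 0 :> R[i].
  by rewrite rmorphB rmorph1 /= map_polyXn hornerD hornerN hornerXn hornerC zm
    subrr.
by rewrite /qpoch big_nat_recr//= !rmorphM !hornerM q0 !mulr0.
Qed.

Lemma habiro_evE (z : R[i]) (f : habiro) n m p : z ^+ m.+1 = 1 -> (m <= n)%N ->
  f n = \pi_(habiro_level n) p -> habiro_ev z f = (map_poly intr p).[z].
Proof.
move=> zm mn fnp; rewrite /habiro_ev.
case: xgetP => [k _ zk|/(_ m)//].
set l := maxn k n.
suff aux j i r : z ^+ j.+1 = 1 -> (j <= i)%N -> (i <= l)%N ->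
    f i = \pi_(habiro_level i) r ->
    (map_poly intr r).[z] = (map_poly intr (repr (f l))).[z].
  rewrite (aux m n p)// ?leq_maxr//; apply: (aux k k) => //.
    exact: leq_maxl.
  by rewrite reprK.
move=> zj ji il fir; apply/eqP; rewrite -subr_eq0 -hornerN -hornerD -rmorphB.
apply/eqP/(qpoch_ideal_root zj ji)/habiro_level_eq.
by rewrite -fir; exact: habiro_repr.
Qed.

Lemma habiro_ev_rmorphism (z : R[i]) : root_of_unity z ->
  [/\ {morph habiro_ev z : f g / f + g}, {morph habiro_ev z : f g / f * g},
      habiro_ev z 1 = 1 & habiro_ev z habiro_q = z].
Proof.
case=> [[//|m] _ /unity_rootP zm].
have ev (f : habiro) p : f m = \pi_(habiro_level m) p -> habiro_ev z f = (map_poly intr p).[z].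
  exact: habiro_evE zm (leqnn m).
split=> [f g|f g||].
- rewrite (ev f (repr (f m))) ?reprK// (ev g (repr (g m))) ?reprK//.
  rewrite -hornerD -rmorphD; apply: ev.
  by apply: etrans (esym (rmorphD _ _ _)) => /=; rewrite !reprK.
- rewrite (ev f (repr (f m))) ?reprK// (ev g (repr (g m))) ?reprK//.
  rewrite -hornerM -rmorphM; apply: ev.
  by apply: etrans (esym (rmorphM _ _ _)) => /=; rewrite !reprK.
- by rewrite (ev _ 1)// rmorph1 hornerC.
- by rewrite (ev _ 'X)// map_polyX hornerX.
Qed.

Definition E_op (z : R[i]) (f : habiro) : ell2 R -> ell2 R :=
  diag_op (fun n => habiro_ev (z ^+ n.+1) f).

Lemma E_op_eps z f n :
  E_op z f (ell2_eps n) = habiro_ev (z ^+ n.+1) f *: ell2_eps n.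
Proof. exact: diag_op_eps. Qed.

Lemma E_opE z f x n : root_of_unity z ->
  E_op z f x n = habiro_ev (z ^+ n.+1) f * x n.
Proof.
case=> [[//|m] _ /unity_rootP zm].
have n0 (y : R[i]) : 0 <= normc y by case: y => a b; exact: sqrtr_ge0.
pose g (i : 'I_m.+1) : R := normc (habiro_ev (z ^+ i) f).
apply: (@diag_opE _ _ _ (\sum_i g i)) => k.
rewrite (divn_eq k.+1 m.+1) exprD mulnC exprM zm expr1n mul1r.
have km : (k.+1 %% m.+1 < m.+1)%N by rewrite ltn_mod.
rewrite (bigD1 (Ordinal km))//= /g /= lerDl sumr_ge0// => i _; exact: n0.
Qed.

Definition cstar_habiro : set (ell2 R -> ell2 R) :=
  op_cstar_generated
    [set T | exists z, exists f, root_of_unity z /\ T = E_op z f].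

End Evaluation.

Arguments cstar_habiro R : clear implicits.

Definition int_rat (x : rat) : bool := x \is a Num.int.

Fact int_rat_zmod_closed : zmod_closed int_rat.
Proof. by split=> [|x y]; [exact: rpred0 | exact: rpredB]. Qed.

HB.instance Definition _ := GRing.isZmodClosed.Build rat int_rat
  int_rat_zmod_closed.

Definition QZ := Quotient.quot (GRing.ZmodClosed.clone rat int_rat _).
HB.instance Definition _ := GRing.Zmodule.on QZ.

Section Embedding.
Variable R : realType.

Definition expi (t : R) : R[i] := (cos t +i* sin t)%C.

(* The standard identification r |-> exp(2 pi i r) of Q/Z with the roots of
   unity in C. *)
Definition expQZ (x : QZ) : R[i] := expi (2 * pi * ratr (repr x)).

(* The embedding r |-> rho(r) of Q/Z in C^* attached to an automorphism rho of
   Q/Z, i.e. to an element of \hat{Z}^*. *)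
Definition embQZ (rho : {additive QZ -> QZ}) (r : QZ) : R[i] := expQZ (rho r).

Lemma expiD (s t : R) : expi (s + t) = expi s * expi t.
Proof. by rewrite /expi cosD sinD; congr Complex; rewrite addrC. Qed.

Lemma expi_2pi_nat (n : nat) : expi (2 * pi * n%:R) = 1.
Proof.
elim: n => [|n IH]; first by rewrite mulr0 /expi cos0 sin0.
rewrite -[n.+1%:R]natr1 mulrDr expiD IH mul1r mulr1 mulr_natl.
by rewrite /expi cos2pi sin2pi.
Qed.

Lemma expi_2pi_int (k : int) : expi (2 * pi * k%:~R) = 1.
Proof.
case: k => n; first exact: expi_2pi_nat.
rewrite NegzE mulrNz mulrN.
have := expiD (- (2 * pi * n.+1%:R)) (2 * pi * n.+1%:R).
rewrite addNr expi_2pi_nat mulr1 => <-.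
by have := expi_2pi_nat 0; rewrite mulr0.
Qed.

Lemma expQZ_pi (a : rat) : expQZ (\pi_QZ a) = expi (2 * pi * ratr a).
Proof.
rewrite /expQZ; set b := repr _.
have /intrP[k bk] : b - a \is a Num.int.
  have /eqP : \pi_QZ b = \pi_QZ a by rewrite reprK.
  by rewrite -Quotient.idealrBE.
by rewrite -(subrK a b) bk rmorphD /= ratr_int mulrDr expiD expi_2pi_int mul1r.
Qed.

Lemma expQZD (x y : QZ) : expQZ (x + y) = expQZ x * expQZ y.
Proof.
have -> : x + y = \pi_QZ (repr x + repr y).
  by apply: etrans (esym (raddfD _ _ _)) => /=; rewrite !reprK.
by rewrite expQZ_pi rmorphD /= mulrDr expiD.
Qed.

Lemma expQZ_root_of_unity (x : QZ) : root_of_unity (expQZ x).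
Proof.
have eX (t : R) n : expi t ^+ n = expi (t * n%:R).
  elim: n => [|n IH]; first by rewrite expr0 mulr0 /expi cos0 sin0.
  by rewrite exprSr IH -[n.+1%:R]natr1 mulrDr mulr1 expiD.
rewrite /expQZ; set a := repr x.
exists `|denq a|%N; first by rewrite absz_gt0 denq_neq0.
apply/unity_rootP; rewrite eX -mulrA.
have -> : ratr a * `|denq a|%N%:R = (numq a)%:~R :> R.
  rewrite /ratr -mulrA (_ : `|denq a|%N%:R = (denq a)%:~R).
    by rewrite mulVf ?mulr1// intr_eq0 denq_neq0.
  by rewrite pmulrn gez0_abs// denq_ge0.
exact: expi_2pi_int.
Qed.

End Embedding.

Arguments embQZ R rho r : clear implicits.

(* Main.v *)
Require Import Defs.
From HB Require Import structures.
From mathcomp Require Import all_boot all_order all_algebra complex.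
From mathcomp Require Import all_classical all_reals all_analysis.
From mathcomp Require Import ring lra.

Import Order.TTheory GRing.Theory Num.Theory numFieldNormedType.Exports.
Import ComplexField.Normc.
Local Open Scope classical_set_scope.
Local Open Scope ring_scope.

(** Write [rho(r)] for the root of unity attached to [r] in Q/Z.  For each
    positive integer [n], the map [r |-> rho(r)^n] is a unitary representation
    of Q/Z in the complex numbers, so the universal property of [A] gives a
    character [chi n] of [A] with [chi n (e r) = rho(r)^n]; in the code the
    index [n : nat] stands for the integer [n.+1].  The isomorphism is the
    direct sum [phi] of these characters: [phi a] is the diagonal operator with
    entries [chi n a].  On the generators, [phi (e r)] is the operator
    [E_(rho(r), q)].

    The heart of the matter is that [phi] is isometric, which says that the
    positive integers are dense in the dual group of Q/Z.  Characters are
    contractive ([character_le], by the Neumann series).  Conversely, the span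
    of the generators is dense ([QZ_span_dense]), and since Q/Z is a union of
    finite cyclic groups, an element of the span is a polynomial [p u] in
    [u = e (1/N)] for some [N].  Lagrange interpolation at the [N]-th roots of
    unity bounds [p u] by a constant times the largest value of [p] there;
    applying this to the powers of the self-adjoint element [(p u)^* (p u)],
    whose norms are given by the C*-identity, turns the constant into 1
    ([cnorm_horner_le]).  These values of [p] are values of the [chi n], because
    [rho (1/N)] is a primitive [N]-th root of unity and its powers with positive
    exponents are all the [N]-th roots of unity ([cnorm_le_characters]).

    It follows that [phi] is injective with closed range.  The range is the
    algebra generated by the [E_(z, f)]: a root of unity [z] is some [rho(r)],
    and as [z] has finite order, [f] acts at the powers of [z] through a
    polynomial, so that [E_(z, f)] is the image of a polynomial in [e r]; in the
    other direction [A] is generated by the [e r] ([range_diag_rep]).  Finally,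
    two such isomorphisms differ by an endomorphism of [A] that fixes the
    generators, which is the identity by the universal property. *)

(** * Real sequences and complex numbers *)

Section Preliminaries.
Context {R : realType}.

Lemma cvg_to0P (u : nat -> R) :
  u n @[n --> \oo] --> (0 : R) <->
  forall eps : R, 0 < eps ->
    exists N : nat, forall n : nat, (N <= n)%N -> `|u n| < eps.
Proof.
split=> [/cvgr0Pnorm_lt cu eps e0|cu].
  by have [N _ Nu] := cu _ e0; exists N => n; exact: Nu.
apply/cvgr0Pnorm_lt => eps /cu[N Nu]; exists N => //.
Qed.

Lemma normc_ge0 (z : R[i]) : 0 <= normc z.
Proof. by case: z => a b; exact: sqrtr_ge0. Qed.

Lemma normcX (z : R[i]) n : normc (z ^+ n) = normc z ^+ n.
Proof.
elim: n => [|n IH]; first by rewrite !expr0 normc1.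
by rewrite !exprS normcM IH.
Qed.

Lemma normcB (x y : R[i]) : normc (x - y) = normc (y - x).
Proof. by rewrite -(opprB y x) normcN. Qed.

Lemma normc_conj (z : R[i]) : normc z^*%C = normc z.
Proof. by case: z => a b; rewrite /= sqrrN. Qed.

Lemma normc_Re (z : R[i]) : `|complex.Re z| <= normc z.
Proof.
case: z => a b; rewrite /= -[leLHS]sqrtr_sqr ler_sqrt ?addr_ge0 ?sqr_ge0//.
by rewrite lerDl sqr_ge0.
Qed.

Lemma normc_Im (z : R[i]) : `|complex.Im z| <= normc z.
Proof.
case: z => a b; rewrite /= -[leLHS]sqrtr_sqr ler_sqrt ?addr_ge0 ?sqr_ge0//.
by rewrite lerDr sqr_ge0.
Qed.

Lemma normc_le_ReIm (z : R[i]) :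
  normc z <= `|complex.Re z| + `|complex.Im z|.
Proof.
case: z => a b /=; rewrite -[leRHS]ger0_norm ?addr_ge0// -sqrtr_sqr.
rewrite ler_sqrt ?sqr_ge0//.
rewrite -(real_normK (num_real a)) -(real_normK (num_real b)).
move: (normr_ge0 a) (normr_ge0 b); move: `|a| `|b| => x y x0 y0; nra.
Qed.

Lemma normc_conjM (z : R[i]) : z^*%C * z = (normc z ^+ 2)%:C%C.
Proof.
case: z => a b; rewrite /= sqr_sqrtr ?addr_ge0 ?sqr_ge0//.
by apply/eqP; rewrite eq_complex /=; apply/andP; split; apply/eqP; ring.
Qed.

Lemma normc_real (x : R) : 0 <= x -> normc x%:C%C = x.
Proof. by move=> x0; rewrite /= expr0n addr0 sqrtr_sqr ger0_norm. Qed.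

Lemma real_cauchy_cvg (u : nat -> R) :
  (forall eps : R, 0 < eps -> exists N : nat, forall m n : nat,
    (N <= m)%N -> (N <= n)%N -> `|u m - u n| < eps) ->
  exists l : R, u n - l @[n --> \oo] --> (0 : R).
Proof.
move=> cu; have /cauchy_cvgP cvu : cauchy (u n @[n --> \oo]).
  apply: cauchy_exP => eps e0; have [N Nu] := cu _ e0.
  by exists (u N); exists N => // n /= Nn; apply: Nu.
by exists (limn u); apply/subr_cvg0.
Qed.

(** Completeness of the complex field, in the form asked for C*-algebras. *)
Lemma complex_cauchy_cvg (u : nat -> R[i]) :
  (forall eps : R, 0 < eps -> exists N : nat, forall m n : nat,
    (N <= m)%N -> (N <= n)%N -> normc (u m - u n) < eps) ->
  exists l : R[i], normc (u n - l) @[n --> \oo] --> (0 : R).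
Proof.
move=> cu.
have [|a /cvg_to0P ua] := @real_cauchy_cvg (fun n => complex.Re (u n)).
  move=> eps /cu[N Nu]; exists N => m n Nm Nn.
  by rewrite -raddfB /=; apply: le_lt_trans (normc_Re _) (Nu _ _ Nm Nn).
have [|b /cvg_to0P ub] := @real_cauchy_cvg (fun n => complex.Im (u n)).
  move=> eps /cu[N Nu]; exists N => m n Nm Nn.
  by rewrite -raddfB /=; apply: le_lt_trans (normc_Im _) (Nu _ _ Nm Nn).
exists (a +i* b)%C; apply/cvg_to0P => eps e0.
have e2 : 0 < eps / 2 by rewrite divr_gt0.
have [N Na] := ua _ e2; have [M Mb] := ub _ e2.
exists (maxn N M) => n; rewrite geq_max => /andP[/Na nN /Mb nM].
rewrite ger0_norm ?normc_ge0//; apply: le_lt_trans (normc_le_ReIm _) _.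
rewrite !raddfB /= (splitr eps); exact: ltrD.
Qed.

(** A geometric sequence of ratio greater than one is unbounded. *)
Lemma exp_unbounded (q C : R) : 1 < q ->
  exists k, forall m, (k <= m)%N -> C < q ^+ m.
Proof.
move=> q1; have B n : 1 + (q - 1) *+ n <= q ^+ n.
  elim: n => [|n IH]; first by rewrite mulr0n addr0 expr0.
  have q0 : 0 <= q by apply: le_trans (ltW q1).
  rewrite exprS; apply: le_trans (ler_wpM2l q0 IH).
  rewrite mulrSr -mulr_natr -subr_ge0.
  have aux (t : R) : q * (1 + (q - 1) * t) - (1 + ((q - 1) * t + (q - 1))) =
    (q - 1) ^+ 2 * t by ring.
  by rewrite aux mulr_ge0 ?sqr_ge0.
have q10 : 0 < q - 1 by rewrite subr_gt0.
exists (Num.truncn (`|C| / (q - 1))).+1 => m km.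
apply: lt_le_trans (B m); apply: le_lt_trans (ler_norm C) _.
rewrite -mulr_natr; apply: (@lt_le_trans _ _ (1 + `|C|)).
  by rewrite ltrDr.
rewrite lerD2l mulrC -ler_pdivrMr//; apply/ltW.
by apply: lt_le_trans (truncnS_gt _) _; rewrite ler_nat.
Qed.

Lemma exp_small (q eps : R) : 0 <= q -> q < 1 -> 0 < eps ->
  exists k, forall m, (k <= m)%N -> q ^+ m < eps.
Proof.
rewrite le0r => /orP[/eqP-> _ e0|q0 q1 e0].
  by exists 1%N => -[//|m _]; rewrite expr0n.
have [k kq] := @exp_unbounded q^-1 eps^-1 ltac:(by rewrite invf_gt1).
by exists k => m /kq; rewrite exprVn ltf_pV2 ?posrE ?exprn_gt0.
Qed.

(** Constant factors are invisible to the growth rate along powers of two. *)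
Lemma le_of_exp2_le (t M C : R) : 0 <= M ->
  (forall k, t ^+ (2 ^ k) <= C * M ^+ (2 ^ k)) -> t <= M.
Proof.
move=> M0 tM; rewrite leNgt; apply/negP => Mt.
have t0 : 0 < t by apply: le_lt_trans Mt.
move: M0; rewrite le0r => /orP[/eqP M0|M0].
  have := tM 0%N; rewrite M0 expn0 !expr1 mulr0 => /(lt_le_trans t0).
  by rewrite ltxx.
have [k kq] := @exp_unbounded (t / M) C ltac:(by rewrite ltr_pdivlMr ?mul1r).
have := kq (2 ^ k)%N (ltnW (ltn_expl k (leqnn 2))).
rewrite expr_div_n ltr_pdivlMr ?exprn_gt0// => /lt_le_trans/(_ (tM k)).
by rewrite ltxx.
Qed.

End Preliminaries.

(** * C*-algebra basics *)

Section CstarBasics.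
Context {R : realType} {A : cstarAlgType R}.
Implicit Types x y : A.

Lemma cnorm0 : cnorm (0 : A) = 0.
Proof. by rewrite -(scale0r (0 : A)) cnormZ normc0 mul0r. Qed.

Lemma cnormN x : cnorm (- x) = cnorm x.
Proof. by rewrite -scaleN1r cnormZ normcN normc1 mul1r. Qed.

Lemma cnorm_ge0 x : 0 <= cnorm x.
Proof.
have := cnormD_le x (- x); rewrite subrr cnorm0 cnormN.
by rewrite -mulr2n pmulrn_lge0.
Qed.

Lemma cnormB x y : cnorm (x - y) = cnorm (y - x).
Proof. by rewrite -(opprB y x) cnormN. Qed.

Lemma cnorm_distD (z x y : A) : cnorm (x - y) <= cnorm (x - z) + cnorm (z - y).
Proof. by rewrite (_ : x - y = (x - z) + (z - y)) ?cnormD_le// subrKA. Qed.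

Lemma cnorm_sum (I : Type) (s : seq I) (F : I -> A) :
  cnorm (\sum_(i <- s) F i) <= \sum_(i <- s) cnorm (F i).
Proof.
elim: s => [|i s IH]; first by rewrite !big_nil cnorm0.
by rewrite !big_cons; apply: le_trans (cnormD_le _ _) _; rewrite lerD2l.
Qed.

Lemma star0 : star (0 : A) = 0.
Proof. by have := starZ 0 (0 : A); rewrite conjc0 !scale0r. Qed.

Lemma star1 : star (1 : A) = 1.
Proof. by rewrite -[LHS]mulr1 -[X in _ * X](starK 1) -starM mulr1 starK. Qed.

Lemma starN x : star (- x) = - star x.
Proof. by apply/eqP; rewrite -addr_eq0 -starD addNr star0. Qed.

Lemma starX x n : star (x ^+ n) = star x ^+ n.
Proof.
elim: n => [|n IH]; first by rewrite !expr0 star1.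
by rewrite exprS starM IH -exprSr.
Qed.

Lemma cnorm_star x : cnorm (star x) = cnorm x.
Proof.
have le y : cnorm y <= cnorm (star y).
  have := cnormM_le (star y) y; rewrite cnorm_starM expr2.
  have := cnorm_ge0 y; rewrite le0r => /orP[/eqP->|y0].
    by rewrite cnorm_ge0.
  by rewrite ler_pM2r.
by apply/eqP; rewrite eq_le le -{2}(starK x) le.
Qed.

Lemma cnormX_le x n : cnorm (x ^+ n.+1) <= cnorm x ^+ n.+1.
Proof.
elim: n => [|n IH]; first by rewrite !expr1.
rewrite !(exprS _ n.+1); apply: le_trans (cnormM_le _ _) _.
by rewrite ler_wpM2l ?cnorm_ge0.
Qed.

(** Iterating the C*-identity on a self-adjoint element computes the norm
    from high powers. *)
Lemma cnorm_selfadjoint_exp2 x k : star x = x ->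
  cnorm (x ^+ (2 ^ k)) = cnorm x ^+ (2 ^ k).
Proof.
move=> xx; elim: k => [|k IH]; first by rewrite expn0 !expr1.
by rewrite expnS mulnC !exprM -IH -cnorm_starM starX xx expr2.
Qed.

Lemma cnorm_lim_unique (u : nat -> A) (l l' : A) :
  (forall eps : R, 0 < eps ->
    exists n, cnorm (u n - l) < eps /\ cnorm (u n - l') < eps) ->
  l = l'.
Proof.
move=> ll; apply/eqP; rewrite -subr_eq0; apply/eqP/cnorm0_eq0/eqP.
rewrite eq_le cnorm_ge0 andbT; apply/ler_addgt0Pl => e e0; rewrite addr0.
have [|n [nl nl']] := ll (e / 2); first by rewrite divr_gt0.
apply: le_trans (cnorm_distD (u n) _ _) _; rewrite cnormB (splitr e).
by rewrite ltW// ltrD.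
Qed.

(** The Neumann series: [1 - y] is left invertible as soon as [y] has norm less
    than one. *)
Lemma neumann y : cnorm y < 1 -> exists z : A, z * (1 - y) = 1.
Proof.
move=> y1; pose s n := \sum_(i < n) y ^+ i.
have sS n : s n.+1 = s n + y ^+ n by rewrite /s big_ord_recr.
have sE n : s n * (1 - y) = 1 - y ^+ n.
  elim: n => [|n IH]; first by rewrite /s big_ord0 mul0r expr0 subrr.
  by rewrite sS mulrDl IH mulrBr mulr1 -exprSr addrA subrK.
have y10 : 0 < 1 - cnorm y by rewrite subr_gt0.
have sle m k : cnorm (s (m.+1 + k)%N - s m.+1) * (1 - cnorm y)
    <= cnorm y ^+ m.+1 * (1 - cnorm y ^+ k).
  elim: k => [|k IH].
    by rewrite addn0 subrr cnorm0 mul0r expr0 subrr mulr0.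
  rewrite addnS sS addrAC.
  apply: (@le_trans _ _ ((cnorm (s (m.+1 + k)%N - s m.+1) +
      cnorm y ^+ (m.+1 + k)) * (1 - cnorm y))).
    apply: ler_wpM2r; first exact: ltW.
    apply: le_trans (cnormD_le _ _) _.
    by rewrite lerD2l addSn; exact: cnormX_le.
  rewrite mulrDl; apply: le_trans (lerD IH (lexx _)) _.
  by rewrite exprD exprS (exprS _ k) le_eqVlt; apply/orP; left; apply/eqP; ring.
have [|l /cvg_to0P sl] := @cnorm_complete _ A (fun n => s n.+1).
  have small eps : 0 < eps -> exists N : nat, forall m k : nat,
      (N <= m)%N -> cnorm (s (m.+1 + k)%N - s m.+1) < eps.
    move=> e0.
    have [|N Ny] := @exp_small _ _ (eps * (1 - cnorm y)) (cnorm_ge0 y) y1.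
      by rewrite mulr_gt0.
    exists N => m k Nm; rewrite -(ltr_pM2r y10); apply: le_lt_trans (sle m k) _.
    apply: le_lt_trans (Ny _ (leqW Nm)).
    rewrite ler_piMr ?exprn_ge0 ?cnorm_ge0//.
    by rewrite gerBl exprn_ge0 ?cnorm_ge0.
  move=> eps /small[N Ns]; exists N => m n Nm Nn.
  have [mn|/ltnW nm] := leqP m n.
    by rewrite cnormB -(subnKC mn) -addSn; exact: Ns.
  by rewrite -(subnKC nm) -addSn; exact: Ns.
exists l; apply: (@cnorm_lim_unique (fun n => s n.+1 * (1 - y))) => eps e0.
have c0 : 0 < cnorm (1 - y) + 1 by rewrite ltr_wpDl ?cnorm_ge0.
have [|N Nl] := sl (eps / (cnorm (1 - y) + 1)); first by rewrite divr_gt0.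
have [M My] := @exp_small _ (cnorm y) eps (cnorm_ge0 y) y1 e0.
exists (maxn N M); split.
  rewrite -mulrBl; apply: le_lt_trans (cnormM_le _ _) _.
  have := Nl _ (leq_maxl N M); rewrite ger0_norm ?cnorm_ge0// ltr_pdivlMr//.
  by apply: le_lt_trans; rewrite ler_wpM2l ?cnorm_ge0// lerDl.
rewrite sE addrAC subrr add0r cnormN; apply: le_lt_trans (cnormX_le _ _) _.
by apply: My; rewrite (leq_trans (leq_maxr N M)).
Qed.

End CstarBasics.

(** * The complex numbers as a C*-algebra, and characters *)

Fact complex_cnorm_starM (R : realType) (x : R[i]^o) :
  normc ((x^*%C : R[i]) * x) = normc x ^+ 2.
Proof. by rewrite normcM normc_conj expr2. Qed.

Fact complex_starZ (R : realType) (a : R[i]) (x : R[i]^o) :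
  (a *: x : R[i])^*%C = a^*%C *: (x^*%C : R[i]^o).
Proof. exact: rmorphM. Qed.

Fact complex_starM (R : realType) (x y : R[i]^o) :
  (x * y : R[i])^*%C = (y^*%C : R[i]) * x^*%C.
Proof. by rewrite mulrC; exact: rmorphM. Qed.

(* [R[i]^o] is the complex field as an algebra over itself; the norm is the
   modulus and the star is the conjugation. *)
HB.instance Definition _ (R : realType) := isCstarAlgebra.Build R R[i]^o
  (@eq0_normc R) (@le_normcD R) (@normcM R)
  (fun x y => eq_ind_r (fun t => t <= _) (lexx _) (normcM x y))
  (@complex_cauchy_cvg R) (@conjcK R) (rmorphD _) (@complex_starZ R)
  (@complex_starM R) (@complex_cnorm_starM R).

Section StarMorphisms.
Context {R : realType} {A B : cstarAlgType R} {f : A -> B}.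
Hypothesis fm : star_morphism f.

Lemma starmD x y : f (x + y) = f x + f y.
Proof. by have := starm_linear fm 1 x y; rewrite !scale1r. Qed.

Lemma starm0 : f 0 = 0.
Proof. by apply: (addrI (f 0)); rewrite -starmD !addr0. Qed.

Lemma starmZ a x : f (a *: x) = a *: f x.
Proof. by rewrite -[a *: x]addr0 (starm_linear fm) starm0 addr0. Qed.

Lemma starmN x : f (- x) = - f x.
Proof. by rewrite -scaleN1r starmZ scaleN1r. Qed.

Lemma starmB x y : f (x - y) = f x - f y.
Proof. by rewrite starmD starmN. Qed.

Lemma starm1 : f 1 = 1.
Proof. by case: (starm_mul fm). Qed.

Lemma starmM x y : f (x * y) = f x * f y.
Proof. by case: (starm_mul fm). Qed.

Lemma starm_horner (u : A) (p : {poly R[i]}) :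
  f (horner_alg u p) = horner_alg (f u) p.
Proof.
elim/poly_ind: p => [|p c IH]; first by rewrite !rmorph0 starm0.
by rewrite !rmorphD !rmorphM /= !horner_algX !horner_algC starmD starmM IH
  starmZ starm1.
Qed.

End StarMorphisms.

(** A character takes values in the spectrum, which lies in the disc of
    radius the norm; so no continuity needs to be assumed. *)
Lemma character_le (R : realType) (A : cstarAlgType R) (chi : A -> R[i]^o)
  (x : A) : star_morphism chi -> normc (chi x) <= cnorm x.
Proof.
move=> chim; rewrite leNgt; apply/negP => xchi.
have chi0 : 0 < normc (chi x) by apply: le_lt_trans xchi; exact: cnorm_ge0.
have chiN0 : chi x != 0 by apply: contraTneq chi0 => ->; rewrite normc0 ltxx.
have [|z] := @neumann _ _ ((chi x : R[i])^-1 *: x).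
  by rewrite cnormZ normcV mulrC ltr_pdivrMr ?mul1r.
move=> /(congr1 chi); rewrite (starmM chim) (starmB chim) (starmZ chim).
rewrite (starm1 chim) (_ : _ *: _ = 1); last exact: mulVf.
by rewrite subrr mulr0 => /esym/eqP; rewrite oner_eq0.
Qed.

(** * Polynomials in a unitary of finite order *)

Section FiniteOrder.
Context {R : realType} {A : cstarAlgType R}.
Implicit Types (u : A) (p g : {poly R[i]}).

Lemma star_horner u p :
  star (horner_alg u p) = horner_alg (star u) (map_poly conjc p).
Proof.
elim/poly_ind: p => [|p c IH]; first by rewrite !rmorph0 star0.
rewrite !rmorphD !rmorphM /= map_polyX map_polyC /= !horner_algX !horner_algC.
rewrite starD starM IH starZ star1; congr (_ + _).
by rewrite -{1}(horner_algX (star u)) -rmorphM mulrC rmorphM /= horner_algX.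
Qed.

Lemma horner_alg_Xn u n p :
  horner_alg (u ^+ n) p = horner_alg u (p \Po 'X^n).
Proof.
elim/poly_ind: p => [|p c IH]; first by rewrite comp_poly0 !rmorph0.
rewrite comp_polyD comp_polyM comp_polyX comp_polyC !rmorphD !rmorphM /= IH.
by rewrite rmorphXn /= !horner_algX !horner_algC.
Qed.

(** The Lagrange interpolation polynomial of the points of [s] at [a]. *)
Definition lagrange_at (s : seq R[i]) (a : R[i]) : {poly R[i]} :=
  \prod_(b <- rem a s) ((a - b)^-1 *: ('X - b%:P)).

Lemma lagrange_at_eval (s : seq R[i]) (a b : R[i]) : uniq s -> a \in s ->
  b \in s -> (lagrange_at s a).[b] = (b == a)%:R.
Proof.
move=> us sa sb; rewrite /lagrange_at horner_prod.
have [->|ba] := eqVneq b a.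
  rewrite big_seq big1// => c; rewrite mem_rem_uniq// inE => /andP[ca _].
  by rewrite hornerZ hornerXsubC mulVf// subr_eq0 eq_sym.
have sab : b \in rem a s by rewrite mem_rem_uniq// inE ba.
by rewrite (big_rem b)//= hornerZ hornerXsubC subrr mulr0 mul0r.
Qed.

Lemma horner_lagrange u (s : seq R[i]) g : uniq s ->
  horner_alg u (\prod_(a <- s) ('X - a%:P)) = 0 ->
  horner_alg u g = \sum_(a <- s) g.[a] *: horner_alg u (lagrange_at s a).
Proof.
move=> us us0; pose r := g - \sum_(a <- s) g.[a] *: lagrange_at s a.
have : \prod_(a <- s) ('X - a%:P) %| r.
  apply: uniq_roots_dvdp; last by rewrite uniq_rootsE.
  apply/allP => b sb; rewrite rootE /r hornerD hornerN horner_sum subr_eq0.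
  rewrite (bigD1_seq b)//= hornerZ lagrange_at_eval// eqxx mulr1 big_seq_cond.
  rewrite big1 ?addr0// => a /andP[sa ab].
  by rewrite hornerZ lagrange_at_eval// eq_sym (negbTE ab) mulr0.
move=> /Pdiv.Field.dvdpP[q rq]; have : horner_alg u r = 0.
  by rewrite rq rmorphM /= us0 mulr0.
rewrite /r rmorphB rmorph_sum /= => /eqP; rewrite subr_eq0 => /eqP ->.
by apply: eq_bigr => a _; rewrite linearZ /= mulr_algl.
Qed.

(** Spectral bound: a polynomial in a unitary of order dividing [N] is bounded
    by its values at the [N]-th roots of unity.  Lagrange interpolation gives
    this up to a constant depending on [N] only, and the C*-identity removes
    the constant. *)
Lemma cnorm_horner_le u (N : nat) (w : R[i]) p (M : R) :
  N.-primitive_root w -> u ^+ N = 1 -> star u * u = 1 -> 0 <= M ->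
  (forall i, normc p.[w ^+ i] <= M) -> cnorm (horner_alg u p) <= M.
Proof.
move=> pw uN suu M0 pM; have N0 := prim_order_gt0 pw.
pose s := [seq w ^+ i | i <- index_iota 0 N].
have us : uniq s.
  rewrite map_inj_in_uniq ?iota_uniq// => i j; rewrite !mem_index_iota /=.
  by move=> iN jN /eqP; rewrite (eq_prim_root_expr pw) !modn_small// => /eqP.
have s0 : horner_alg u (\prod_(a <- s) ('X - a%:P)) = 0.
  rewrite /s big_map (factor_Xn_sub_1 pw) rmorphB rmorph1 rmorphXn /=.
  by rewrite horner_algX uN subrr.
have su : star u = u ^+ N.-1.
  rewrite -[LHS]mulr1 -uN -(prednK N0) exprS mulrA suu mul1r.
  by rewrite prednK.
(* As [star u = u ^+ N.-1] and [w^* = w ^+ N.-1], the polynomial [h] represents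
   [star (p u) * p u] and takes the values [|p|^2] at the powers of [w]. *)
pose h := (map_poly conjc p \Po 'X^(N.-1)) * p.
have hE : star (horner_alg u p) * horner_alg u p = horner_alg u h.
  by rewrite star_horner su horner_alg_Xn -rmorphM.
have w1 : (w^*)%C = w ^+ N.-1.
  have wN : w ^+ N = 1 := prim_expr_order pw.
  have nw : normc w = 1.
    apply/eqP; rewrite -(@pexpr_eq1 _ _ N) ?normc_ge0// -?normcX ?wN ?normc1//.
  have ww : (w^*)%C * w = 1 by rewrite normc_conjM nw expr1n.
  by rewrite -[LHS]mulr1 -wN -(prednK N0) exprS mulrA ww mul1r prednK.
have hM i : normc h.[w ^+ i] <= M ^+ 2.
  rewrite hornerM horner_comp hornerXn -exprM mulnC exprM -w1 -rmorphXn /=.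
  rewrite horner_map /= normc_conjM normc_real ?sqr_ge0//.
  by rewrite ler_pXn2r ?nnegrE ?normc_ge0.
rewrite -(@ler_pXn2r _ 2) ?nnegrE ?cnorm_ge0// -cnorm_starM hE.
pose C := \sum_(a <- s) cnorm (horner_alg u (lagrange_at s a)).
apply: (@le_of_exp2_le _ _ _ C).
  exact: sqr_ge0.
move=> k; rewrite -cnorm_selfadjoint_exp2; last by rewrite -hE starM starK.
rewrite -rmorphXn /= (horner_lagrange _ _ _ us s0).
apply: le_trans (cnorm_sum _ _ _) _; rewrite mulr_suml big_seq [leRHS]big_seq.
apply: ler_sum => a /mapP[i _ ->]; rewrite cnormZ mulrC ler_wpM2l ?cnorm_ge0//.
by rewrite horner_exp normcX ler_pXn2r ?nnegrE ?normc_ge0 ?sqr_ge0 ?expn_gt0.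
Qed.

End FiniteOrder.

(** * Roots of unity and the group Q/Z *)

Section RootsOfUnity.
Context {R : realType}.

(** The class of [1 / N.+1] in Q/Z; it generates the subgroup of order
    [N.+1]. *)
Definition invQZ (N : nat) : QZ := \pi_QZ%qT (N.+1%:R^-1 : rat).

Lemma invQZMn N k : invQZ N *+ k = \pi_QZ%qT (k%:R / N.+1%:R : rat).
Proof. by rewrite /invQZ -raddfMn /= mulr_natl. Qed.

Lemma piQZ_int (a : rat) : a \is a Num.int -> \pi_QZ%qT a = 0 :> QZ.
Proof.
move=> ai; rewrite -(raddf0 \pi_QZ%qT); apply/eqP.
by rewrite -Quotient.idealrBE subr0.
Qed.

Lemma invQZ_order N : invQZ N *+ N.+1 = 0.
Proof. by rewrite invQZMn divff ?pnatr_eq0// piQZ_int. Qed.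

Lemma QZ_invQZ (x : QZ) : exists N k, x = invQZ N *+ k.
Proof.
rewrite -[x]reprK; set a := repr x.
have d0 : (0 < denq a)%R := denq_gt0 a.
have dE : (`|denq a|.-1.+1 = `|denq a|)%N by rewrite prednK// absz_gt0 gt_eqF.
exists `|denq a|.-1, `|(numq a %% denq a)%Z|%N; rewrite invQZMn dE.
apply/eqP; rewrite -subr_eq0 -raddfB; apply/eqP/piQZ_int.
have -> : (`|denq a|%N%:R : rat) = (denq a)%:~R.
  by rewrite pmulrn gez0_abs// ltW.
have -> : (`|(numq a %% denq a)%Z|%N%:R : rat) = (numq a %% denq a)%Z%:~R.
  by rewrite pmulrn gez0_abs// modz_ge0// gt_eqF.
rewrite -{1}(divq_num_den a) -mulrBl -rmorphB /= {1}(divz_eq (numq a) (denq a)).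
by rewrite addrK rmorphM /= mulfK ?intr_eq0 ?gt_eqF// intr_int.
Qed.

Lemma expQZ0 : expQZ R 0 = 1.
Proof.
by have := expQZ_pi R 0; rewrite raddf0 rmorph0 mulr0 /expi cos0 sin0.
Qed.

Lemma expQZMn (x : QZ) n : expQZ R (x *+ n) = expQZ R x ^+ n.
Proof.
elim: n => [|n IH]; first by rewrite mulr0n expQZ0.
by rewrite mulrS expQZD IH exprS.
Qed.

Lemma normc_expQZ (x : QZ) : normc (expQZ R x) = 1.
Proof. by rewrite /expQZ /expi /= cos2Dsin2 sqrtr1. Qed.

Lemma expQZN (x : QZ) : expQZ R (- x) = (expQZ R x)^*%C.
Proof.
have xx : (expQZ R x)^*%C * expQZ R x = 1.
  by rewrite normc_conjM normc_expQZ expr1n.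
have xN : expQZ R x * expQZ R (- x) = 1 by rewrite -expQZD addrN expQZ0.
by rewrite -[LHS]mul1r -[in LHS]xx -mulrA xN mulr1.
Qed.

(** By the half-angle formula, [cos t = 1 - 2 sin^2 (t / 2)]. *)
Lemma expi_neq1 (t : R) : 0 < t < 2 * pi -> expi t != 1.
Proof.
move=> /andP[t0 tpi]; apply/eqP => -[ct _].
have st : 0 < sin (t / 2).
  by apply: sin_gt0_pi; rewrite divr_gt0//= ltr_pdivrMr// mulrC.
have := cosD (t / 2) (t / 2); rewrite -splitr ct -!expr2.
have := cos2Dsin2 (t / 2); nra.
Qed.

Lemma expQZ_invQZ_prim N : N.+1.-primitive_root (expQZ R (invQZ N)).
Proof.
apply/andP; split=> //; apply/forallP => i; apply/eqP.
rewrite unity_rootE -expQZMn; have [->|iN] := eqVneq i.+1 N.+1.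
  by rewrite invQZ_order expQZ0 eqxx.
apply/negbTE; rewrite invQZMn expQZ_pi; apply: expi_neq1.
rewrite fmorph_div !rmorph_nat /= mulr_gt0 ?mulr_gt0 ?pi_gt0 ?divr_gt0//=.
rewrite -subr_gt0 -{1}[2 * pi]mulr1 -mulrBr mulr_gt0 ?mulr_gt0 ?pi_gt0//.
by rewrite subr_gt0 ltr_pdivrMr ?ltr0n// mul1r ltr_nat ltn_neqAle iN ltn_ord.
Qed.

Lemma expQZ_eq1 (x : QZ) : expQZ R x = 1 -> x = 0.
Proof.
have [N [k ->]] := QZ_invQZ x; rewrite expQZMn => /eqP.
rewrite -(prim_order_dvd (expQZ_invQZ_prim N)) => /dvdnP[j ->].
by rewrite mulnC mulrnA invQZ_order mul0rn.
Qed.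

Section Embedding.
Variable rho : {additive QZ -> QZ}.

Lemma embQZ_prim N : bijective rho ->
  N.+1.-primitive_root (embQZ R rho (invQZ N)).
Proof.
move=> /bij_inj rinj; apply/andP; split=> //; apply/forallP => i; apply/eqP.
have /andP[_ /forallP/(_ i)/eqP <-] := expQZ_invQZ_prim N.
rewrite !unity_rootE /embQZ -!expQZMn -raddfMn.
apply/eqP/eqP => /expQZ_eq1 => [|->]; last by rewrite raddf0 expQZ0.
by rewrite -(raddf0 rho) => /rinj ->; rewrite expQZ0.
Qed.

Lemma embQZ_surj (z : R[i]) : bijective rho -> Defs.root_of_unity z ->
  exists r, z = embQZ R rho r.
Proof.
move=> rb [[//|N] _ /unity_rootP zN].
have [i ->] := prim_rootP (embQZ_prim N rb) zN.
by exists (invQZ N *+ i); rewrite /embQZ raddfMn expQZMn.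
Qed.

End Embedding.

End RootsOfUnity.

(** * The group C*-algebra of Q/Z *)

Section NormClosure.
Context {R : realType} {A : cstarAlgType R}.

(** The closure of [S] for the norm. *)
Definition norm_closure (S : set A) : set A :=
  [set x | forall eps : R, 0 < eps -> exists2 y, S y & cnorm (x - y) < eps].

Lemma norm_closure_subalgebra (S : set A) :
  (forall (a : R[i]) x y, S x -> S y -> S (a *: x + y)) ->
  (forall x y, S x -> S y -> S (x * y)) ->
  (forall x, S x -> S (star x)) ->
  cstar_subalgebra (norm_closure S).
Proof.
move=> Slin Smul Sstar; split.
- move=> a x y Sx Sy eps e0.
  have a0 : 0 < normc a + 1 by rewrite ltr_wpDl ?normc_ge0.
  have [|x' Sx' xx'] := Sx (eps / 2 / (normc a + 1)).
    by rewrite !divr_gt0.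
  have [|y' Sy' yy'] := Sy (eps / 2); first by rewrite divr_gt0.
  exists (a *: x' + y'); first exact: Slin.
  rewrite opprD addrACA -scalerBr; apply: le_lt_trans (cnormD_le _ _) _.
  rewrite (splitr eps) cnormZ; apply: ler_ltD yy'.
  move: xx'; rewrite ltr_pdivlMr// => /ltW; apply: le_trans.
  by rewrite mulrC ler_wpM2l ?cnorm_ge0// lerDl.
- move=> x y Sx Sy eps e0.
  have x0 : 0 < cnorm x + 1 by rewrite ltr_wpDl ?cnorm_ge0.
  have [|y' Sy' yy'] := Sy (eps / 2 / (cnorm x + 1)).
    by rewrite !divr_gt0.
  have y0 : 0 < cnorm y' + 1 by rewrite ltr_wpDl ?cnorm_ge0.
  have [|x' Sx' xx'] := Sx (eps / 2 / (cnorm y' + 1)).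
    by rewrite !divr_gt0.
  exists (x' * y'); first exact: Smul.
  apply: le_lt_trans (cnorm_distD (x * y') _ _) _.
  rewrite -mulrBr -mulrBl (splitr eps).
  apply: le_lt_trans (lerD (cnormM_le _ _) (cnormM_le _ _)) _.
  apply: ler_ltD.
    move: yy'; rewrite ltr_pdivlMr// => /ltW; apply: le_trans.
    by rewrite mulrC ler_wpM2l ?cnorm_ge0// lerDl.
  move: xx'; rewrite ltr_pdivlMr//; apply: le_lt_trans.
  by rewrite ler_wpM2l ?cnorm_ge0// lerDl.
- move=> x Sx eps /Sx[y Sy xy]; exists (star y); first exact: Sstar.
  by rewrite -starN -starD cnorm_star.
- move=> u l Su /cvg_to0P ul eps e0.
  have e2 : 0 < eps / 2 by rewrite divr_gt0.
  have [N /(_ N (leqnn N))] := ul _ e2; rewrite ger0_norm ?cnorm_ge0// => uN.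
  have [y Sy uy] := Su N _ e2; exists y => //.
  apply: le_lt_trans (cnorm_distD (u N) _ _) _.
  by rewrite (splitr eps) cnormB ltrD.
Qed.

End NormClosure.

Section GroupAlgebra.
Context {R : realType} {A : cstarAlgType R} {e : QZ -> A}.
Hypothesis groupA : is_group_cstar e.

Lemma group_gen_Mn r n : e (r *+ n) = e r ^+ n.
Proof.
have [e0 eD _] := gcstar_rep groupA.
elim: n => [|n IH]; first by rewrite mulr0n e0.
by rewrite mulrS eD IH exprS.
Qed.

Lemma group_gen_unitary r : star (e r) * e r = 1.
Proof.
by have [e0 eD eN] := gcstar_rep groupA; rewrite -eN -eD addNr.
Qed.

(** The linear span of the generators.  Every finite set of generators lies in
    a finite cyclic group, so elements of the span are polynomials in a single
    generator of finite order. *)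
Definition QZ_span : set A :=
  [set x | exists N p, x = horner_alg (e (invQZ N)) p].

Lemma QZ_span_common x y : QZ_span x -> QZ_span y -> exists K p q,
  x = horner_alg (e (invQZ K)) p /\ y = horner_alg (e (invQZ K)) q.
Proof.
move=> [N [p ->]] [M [q ->]].
have lift a b : invQZ a = invQZ (a.+1 * b.+1).-1 *+ b.+1.
  rewrite invQZMn prednK// /invQZ natrM invfM mulrCA divff ?mulr1//.
exists (N.+1 * M.+1).-1, (p \Po 'X^(M.+1)), (q \Po 'X^(N.+1)).
by rewrite (lift N M) (lift M N) mulnC !group_gen_Mn !horner_alg_Xn.
Qed.

Lemma QZ_span_dense (x : A) : norm_closure QZ_span x.
Proof.
suff : cstar_generated (range e) `<=` norm_closure QZ_span.
  by rewrite (gcstar_gen groupA); apply.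
apply: smallest_sub; last first.
  move=> _ [r _ <-] eps e0; exists (e r); last by rewrite subrr cnorm0.
  have [N [k ->]] := QZ_invQZ r; exists N, 'X^k.
  by rewrite rmorphXn /= horner_algX group_gen_Mn.
apply: norm_closure_subalgebra.
- move=> a y z Sy Sz; have [K [p [q [-> ->]]]] := QZ_span_common _ _ Sy Sz.
  by exists K, (a *: p + q); rewrite rmorphD /= linearZ /= mulr_algl.
- move=> y z Sy Sz; have [K [p [q [-> ->]]]] := QZ_span_common _ _ Sy Sz.
  by exists K, (p * q); rewrite rmorphM.
- move=> _ [N [p ->]]; exists N, (map_poly conjc p \Po 'X^N).
  rewrite star_horner -horner_alg_Xn; congr horner_alg.
  have [e0 eD eN] := gcstar_rep groupA; rewrite -eN -group_gen_Mn.
  by congr e; apply: (addrI (invQZ N)); rewrite subrr -mulrS invQZ_order.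
Qed.

Lemma horner_alg_complex (z : R[i]^o) (p : {poly R[i]}) :
  horner_alg z p = p.[z].
Proof.
elim/poly_ind: p => [|p c IH]; first by rewrite rmorph0 horner0.
rewrite rmorphD rmorphM /= horner_algX horner_algC IH hornerMXaddC.
by congr (_ + _); exact: mulr1.
Qed.

Variable rho : {additive QZ -> QZ}.
Hypothesis rho_bij : bijective rho.

(** The unitary character [r |-> rho(r)^(n.+1)] of Q/Z: the image of the
    positive integer [n.+1] in the Pontryagin dual, seen through [rho]. *)
Lemma embQZ_unitary_rep n :
  unitary_rep (fun r => embQZ R rho r ^+ n.+1 : R[i]^o).
Proof.
split=> [|g h|g]; rewrite /embQZ.
- by rewrite raddf0 expQZ0 expr1n.
- by rewrite raddfD expQZD exprMn.
- by rewrite raddfN expQZN -rmorphXn.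
Qed.

Lemma exists_characters : exists chi : nat -> A -> R[i]^o,
  forall n, star_morphism (chi n) /\
    forall r, chi n (e r) = embQZ R rho r ^+ n.+1.
Proof.
suff /choice[chi chiP] : forall n, exists f : A -> R[i]^o,
    star_morphism f /\ forall r, f (e r) = embQZ R rho r ^+ n.+1.
  by exists chi.
move=> n; have [f [fP _]] := gcstar_univ groupA (embQZ_unitary_rep n).
by exists f.
Qed.

Variable chi : nat -> A -> R[i]^o.
Hypothesis chi_morph : forall n, star_morphism (chi n).
Hypothesis chi_gen : forall n r, chi n (e r) = embQZ R rho r ^+ n.+1.

Lemma chi_horner n r p : chi n (horner_alg (e r) p) = p.[embQZ R rho r ^+ n.+1].
Proof. by rewrite (starm_horner (chi_morph n)) chi_gen horner_alg_complex. Qed.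

(** The positive integers are dense in the dual of Q/Z: they fill every finite
    quotient.  So the characters [chi n] compute the norm. *)
Lemma cnorm_le_characters (x : A) (M : R) :
  (forall n, normc (chi n x) <= M) -> cnorm x <= M.
Proof.
move=> xM; apply/ler_addgt0Pl => eps e0.
have e2 : 0 < eps / 2 by rewrite divr_gt0.
have [_ [N [p ->]] xy] := QZ_span_dense x _ e2; set y := horner_alg _ _ in xy.
have M0 : 0 <= M := le_trans (normc_ge0 _) (xM 0%N).
have pw := embQZ_prim (R := R) rho N rho_bij.
have yM : cnorm y <= M + eps / 2.
  apply: (cnorm_horner_le _ _ _ _ _ pw).
  - by have [e0' _ _] := gcstar_rep groupA; rewrite -group_gen_Mn invQZ_order.
  - exact: group_gen_unitary.
  - by rewrite addr_ge0// ltW.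
  (* The character of index [n] evaluates at the power [n.+1]. *)
  move=> i; have -> : embQZ R rho (invQZ N) ^+ i =
      embQZ R rho (invQZ N) ^+ (i + N).+1.
    by rewrite -addnS exprD (prim_expr_order pw) mulr1.
  rewrite -chi_horner -/y -(subrK (chi (i + N)%N x) (chi _ y)) addrC.
  apply: le_trans (le_normcD _ _) _; apply: lerD (xM _) _.
  rewrite -(starmB (chi_morph _)).
  apply: le_trans (character_le _ _ _ _ (chi_morph _)) _.
  by rewrite cnormB ltW.
have := cnorm_distD y x 0; rewrite !subr0 => /le_trans; apply.
rewrite {1}(splitr eps) -addrA [eps / 2 + M]addrC.
by apply: lerD yM; exact: ltW.
Qed.

End GroupAlgebra.

(** * Diagonal operators on the Hilbert space *)

Section DiagonalOperators.
Context {R : realType}.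
Implicit Types (x y : ell2 R) (c : nat -> R[i]).

Lemma ell2_ext x y : (forall n, x n = y n) -> x = y.
Proof. by move=> xy; apply: val_inj; apply/funext. Qed.

Lemma ell2_cvg x : cvgn (series (fun n => normc (x n) ^+ 2 : R)).
Proof. by case: x => x /= /asboolP. Qed.

Lemma ell2_coord_le x k : normc (x k) <= ell2_norm x.
Proof.
rewrite -[leLHS]ger0_norm ?normc_ge0// -sqrtr_sqr ler_sqrt; last first.
  apply: limr_ge (ell2_cvg x) _; near=> n.
  by apply: sumr_ge0 => i _; exact: sqr_ge0.
have nd : {homo series (fun n => normc (x n) ^+ 2 : R) :
    n m / (n <= m)%N >-> n <= m}.
  by apply/nondecreasing_series => n _ _; exact: sqr_ge0.
apply: le_trans (nondecreasing_cvgn_le nd (ell2_cvg x) k.+1).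
rewrite /series /= big_nat_recr//= lerDr sumr_ge0// => i _; exact: sqr_ge0.
Unshelve. all: by end_near. Qed.

Lemma ell2_norm_le (M : R) x y : 0 <= M ->
  (forall k, normc (y k) <= M * normc (x k)) -> ell2_norm y <= M * ell2_norm x.
Proof.
move=> M0 yx; rewrite /ell2_norm -{1}[M]ger0_norm// -sqrtr_sqr.
rewrite -sqrtrM ?sqr_ge0//.
apply: ler_wsqrtr; have cx := ell2_cvg x.
have -> : M ^+ 2 * limn (series (fun n => normc (x n) ^+ 2 : R)) =
    limn (series (M ^+ 2 *: (fun n => normc (x n) ^+ 2 : R))).
  by rewrite lim_seriesZ.
apply: lim_series_le; [exact: ell2_cvg|exact: is_cvg_seriesZ|].
move=> n; rewrite [leRHS](_ : _ = (M * normc (x n)) ^+ 2).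
  by rewrite ler_pXn2r ?nnegrE ?mulr_ge0 ?normc_ge0.
by rewrite exprMn.
Qed.

Lemma ell2_norm_eps k : ell2_norm (ell2_eps k : ell2 R) = 1.
Proof.
rewrite /ell2_norm (_ : limn _ = (1 : R)) ?sqrtr1//.
apply: cvg_lim => //; apply: cvg_near_cst; exists k.+1 => // n kn.
rewrite /series /= (bigD1_seq k) ?iota_uniq ?mem_index_iota//= /eps_seq.
rewrite eqxx normc1 expr1n big1 ?addr0// => i /negbTE ->.
by rewrite normc0 expr0n.
Qed.

Lemma ell2_dot_eps k y : ell2_dot (ell2_eps k) y = (y k)^*%C.
Proof.
rewrite /ell2_dot; apply: (@cvg_lim R[i]^o); first exact: norm_hausdorff.
apply: cvg_near_cst; exists k.+1 => // n kn.
rewrite /series /= (bigD1_seq k) ?iota_uniq ?mem_index_iota//= /eps_seq.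
by rewrite eqxx mul1r big1 ?addr0// => i /negbTE ->; rewrite mul0r.
Qed.

Lemma adjoint_unique (T T1 T2 : ell2 R -> ell2 R) :
  is_adjoint T T1 -> is_adjoint T T2 -> T1 = T2.
Proof.
move=> TT1 TT2; apply/funext => y; apply: ell2_ext => k.
by apply: (can_inj (@conjcK R)); rewrite -!ell2_dot_eps -TT1 -TT2.
Qed.

Lemma diag_op_bounded c (M : R) : (forall n, normc (c n) <= M) ->
  bounded_op (diag_op c).
Proof.
move=> cM; have M0 : 0 <= M := le_trans (normc_ge0 _) (cM 0%N).
have cE x n := diag_opE x n cM; split.
  move=> a x y; apply: ell2_ext => n; rewrite cE.
  rewrite [RHS](_ : _ = a * diag_op c x n + diag_op c y n)//= !cE.
  by rewrite [X in c n * X](_ : _ = a * x n + y n)//=; ring.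
exists M => x; apply: ell2_norm_le => // k.
by rewrite cE normcM ler_wpM2r ?normc_ge0.
Qed.

Lemma diag_op_adjoint c c' (M : R) : (forall n, normc (c n) <= M) ->
  (forall n, c' n = (c n)^*%C) -> is_adjoint (diag_op c) (diag_op c').
Proof.
move=> cM cc' x y; rewrite /ell2_dot.
have c'M n : normc (c' n) <= M by rewrite cc' normc_conj.
suff -> : (fun n => diag_op c x n * (y n)^*%C) =
  (fun n => x n * (diag_op c' y n)^*%C) by [].
apply/funext => n.
rewrite (diag_opE x n cM) (diag_opE y n c'M) cc' rmorphM /= conjcK.
by rewrite (mulrC (c n)) mulrA.
Qed.

End DiagonalOperators.

(** * The representation of the group algebra on the Hilbert space *)

Section Representation.
Context {R : realType} {A : cstarAlgType R}.

(** Two *-isomorphisms onto the same set of operators differ by an endomorphism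
    of the source. *)
Lemma star_iso_onto_factor (S : set (ell2 R -> ell2 R))
    (phi psi : A -> ell2 R -> ell2 R) :
  star_iso_onto S phi -> star_iso_onto S psi -> psi 1 = phi 1 ->
  exists2 g : A -> A, star_morphism g & forall x, phi (g x) = psi x.
Proof.
move=> iphi ipsi psi1.
have /choice[g gE] : forall x, exists y, phi y = psi x.
  move=> x; have : range psi (psi x) by exists x.
  by rewrite (siso_range ipsi) -(siso_range iphi) => -[y _ <-]; exists y.
exists g => //; split.
- move=> a x y; apply: (siso_inj iphi); apply/funext => v.
  by rewrite (siso_lin iphi) !gE (siso_lin ipsi).
- split; first by apply: (siso_inj iphi); rewrite gE.
  move=> x y; apply: (siso_inj iphi).
  by rewrite (siso_mul iphi) !gE (siso_mul ipsi).
- move=> x; apply: (siso_inj iphi); rewrite gE.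
  apply: adjoint_unique (siso_star ipsi x) _.
  by rewrite -gE; exact: siso_star iphi _.
Qed.

Context {e : QZ -> A}.
Hypothesis groupA : is_group_cstar e.
Variable rho : {additive QZ -> QZ}.
Hypothesis rho_bij : bijective rho.
Variable chi : nat -> A -> R[i]^o.
Hypothesis chi_morph : forall n, star_morphism (chi n).
Hypothesis chi_gen : forall n r, chi n (e r) = embQZ R rho r ^+ n.+1.

(** The direct sum of the characters [chi n], acting diagonally. *)
Definition diag_rep (a : A) : ell2 R -> ell2 R := diag_op (fun n => chi n a).

Let chi_le a n : normc (chi n a) <= cnorm a.
Proof. exact: character_le. Qed.

Lemma diag_repE a v n : diag_rep a v n = chi n a * v n.
Proof. exact: (diag_opE v n (chi_le a)). Qed.

Lemma diag_rep_lin (b : R[i]) x y v :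
  diag_rep (b *: x + y) v = b *: diag_rep x v + diag_rep y v.
Proof.
apply: ell2_ext => n.
rewrite [RHS](_ : _ = b * diag_rep x v n + diag_rep y v n)//= !diag_repE.
by rewrite (starm_linear (chi_morph n)) mulrDl -mulrA.
Qed.

Lemma diag_rep_mul x y : diag_rep (x * y) = diag_rep x \o diag_rep y.
Proof.
apply/funext => v; apply: ell2_ext => n.
by rewrite /= !diag_repE (starmM (chi_morph n)) mulrA.
Qed.

Lemma diag_rep_bounded a : bounded_op (diag_rep a).
Proof. exact: diag_op_bounded (chi_le a). Qed.

Lemma diag_rep_star a : is_adjoint (diag_rep a) (diag_rep (star a)).
Proof.
apply: diag_op_adjoint (chi_le a) _ => n; exact: (starm_star (chi_morph n)).
Qed.

Lemma cnormB_le_characters x y (M : R) :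
  (forall n, normc (chi n x - chi n y) <= M) -> cnorm (x - y) <= M.
Proof.
move=> xyM.
apply: (cnorm_le_characters groupA _ rho_bij _ chi_morph chi_gen) => n.
by rewrite (starmB (chi_morph n)).
Qed.

Lemma diag_rep_inj : injective diag_rep.
Proof.
move=> x y xy; apply/eqP; rewrite -subr_eq0; apply/eqP/cnorm0_eq0/eqP.
rewrite eq_le cnorm_ge0 andbT; apply: cnormB_le_characters => n.
have := congr1 (fun T : ell2 R -> ell2 R => T (ell2_eps n) n) xy.
by rewrite !diag_repE /= /eps_seq eqxx !mulr1 => ->; rewrite subrr normc0.
Qed.

Lemma diag_rep_gen r : diag_rep (e r) = E_op (embQZ R rho r) habiro_q.
Proof.
rewrite /diag_rep /E_op; congr diag_op; apply/funext => n; rewrite chi_gen.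
have [|_ _ _ ->//] := @habiro_ev_rmorphism R (embQZ R rho r ^+ n.+1).
by rewrite /embQZ -expQZMn; exact: expQZ_root_of_unity.
Qed.

Lemma E_op_diag_rep z f : Defs.root_of_unity z ->
  exists a, E_op z f = diag_rep a.
Proof.
move=> zr; have [r zE] := embQZ_surj rho z rho_bij zr.
case: zr => -[//|m] _ /unity_rootP zm.
exists (horner_alg (e r) (map_poly intr (repr (f m)))).
rewrite /diag_rep /E_op; congr diag_op; apply/funext => n.
rewrite (chi_horner _ _ chi_morph chi_gen) -zE.
apply: (@habiro_evE R _ f m m) => //; last by rewrite reprK.
by rewrite -exprM mulnC exprM zm expr1n.
Qed.

Lemma op_cvg_diag_rep (u : nat -> A) (l : A) :
  cnorm (u n - l) @[n --> \oo] --> (0 : R) ->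
  op_cvg (fun n => diag_rep (u n)) (diag_rep l).
Proof.
move=> /cvg_to0P ul eps e0; have [N Nu] := ul _ e0.
exists N => n /Nu; rewrite ger0_norm ?cnorm_ge0// => /ltW un x.
apply: ell2_norm_le; first exact: ltW.
move=> k; rewrite [X in normc X](_ : _ = diag_rep (u n) x k - diag_rep l x k)//.
rewrite !diag_repE -mulrBl normcM ler_wpM2r ?normc_ge0//.
by rewrite -(starmB (chi_morph k)); exact: le_trans (chi_le _ _) un.
Qed.

(** A norm limit of operators of the range is recovered from its entries on the
    basis vectors: these show that the preimages form a Cauchy sequence. *)
Lemma range_diag_rep_closed (T : nat -> ell2 R -> ell2 R) L :
  (forall n, range diag_rep (T n)) -> op_cvg T L -> range diag_rep L.
Proof.
move=> RT TL; have /choice[u uT] : forall n, exists a, diag_rep a = T n.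
  by move=> n; have [a _ <-] := RT n; exists a.
have coord (eps : R) : 0 < eps -> exists N : nat, forall n, (N <= n)%N ->
    forall (x : ell2 R) k,
    normc (chi k (u n) * x k - L x k) <= eps * ell2_norm x.
  move=> /TL[N NT]; exists N => n Nn x k; rewrite -diag_repE uT.
  rewrite [X in normc X](_ : _ = (T n x - L x) k)//.
  exact: le_trans (ell2_coord_le _ _) (NT n Nn x).
have [|l ul] := @cnorm_complete R A u.
  move=> eps e0; have [|N Nc] := coord (eps / 2 / 2).
    by rewrite !divr_gt0.
  exists N => m n Nm Nn; apply: (@le_lt_trans _ _ (eps / 2)); last first.
    by rewrite ltr_pdivrMr// ltr_pMr// ltr1n.
  apply: cnormB_le_characters => k.
  move: (Nc m Nm (ell2_eps k) k) (Nc n Nn (ell2_eps k) k).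
  rewrite ell2_norm_eps !mulr1 /= /eps_seq eqxx !mulr1 => mk nk.
  rewrite (splitr (eps / 2)) -(subrKA (L (ell2_eps k) k)).
  apply: le_trans (le_normcD _ _) _; apply: lerD mk _; by rewrite normcB.
exists l => //; apply/funext => x; apply: ell2_ext => k.
rewrite diag_repE; apply/eqP; rewrite -subr_eq0; apply/eqP/eq0_normc/eqP.
rewrite eq_le normc_ge0 andbT; apply/ler_addgt0Pl => d d0; rewrite addr0.
have x0 : 0 <= ell2_norm x := le_trans (normc_ge0 _) (ell2_coord_le x 0).
pose eps := d / 2 / (ell2_norm x + 1).
have e0 : 0 < eps by rewrite !divr_gt0// ltr_wpDl.
have ed : eps * ell2_norm x <= d / 2.
  rewrite /eps mulrAC ler_pdivrMr ?ltr_wpDl//.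
  by rewrite ler_wpM2l ?lerDl// ltW// divr_gt0.
have [N Nc] := coord _ e0; have [M Mu] := (cvg_to0P _).1 ul _ e0.
have := Nc _ (leq_maxl N M) x k; have := Mu _ (leq_maxr N M).
rewrite ger0_norm ?cnorm_ge0//; set n := maxn N M => un cn.
rewrite -(subrKA (chi k (u n) * x k)); apply: le_trans (le_normcD _ _) _.
rewrite (splitr d); apply: lerD (le_trans cn ed).
rewrite -mulrBl normcM; apply: le_trans ed; apply: ler_pM; rewrite ?normc_ge0//.
  rewrite -(starmB (chi_morph k)); apply: le_trans (chi_le _ _) _.
  by rewrite cnormB ltW.
exact: ell2_coord_le.
Qed.

Lemma range_diag_rep : range diag_rep = cstar_habiro R.
Proof.
rewrite eqEsubset; split.
  move=> _ [a _ <-] S [Ssub SE].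
  suff : cstar_generated (range e) `<=` [set x | S (diag_rep x)].
    by rewrite (gcstar_gen groupA); apply.
  apply: smallest_sub; last first.
    move=> _ [r _ <-] /=; rewrite diag_rep_gen; apply: SE.
    by exists (embQZ R rho r), habiro_q; split=> //; exact: expQZ_root_of_unity.
  split=> /=.
  - move=> b x y Sx Sy; rewrite (_ : diag_rep _ =
      (fun v => b *: diag_rep x v + diag_rep y v)).
      exact: (opsub_lin Ssub).
    by apply/funext => v; exact: diag_rep_lin.
  - by move=> x y Sx Sy; rewrite diag_rep_mul; exact: (opsub_comp Ssub).
  - move=> x Sx; apply: (opsub_adjoint Ssub) Sx _ (diag_rep_star x).
    exact: diag_rep_bounded.
  - move=> u l Su ul; apply: (opsub_closed Ssub) Su _ (op_cvg_diag_rep _ _ ul).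
    exact: diag_rep_bounded.
apply: smallest_sub; last first.
  by move=> _ [z [f [zr ->]]]; have [a ->] := E_op_diag_rep z f zr; exists a.
split.
- by move=> _ [a _ <-]; exact: diag_rep_bounded.
- move=> b _ _ [x _ <-] [y _ <-]; exists (b *: x + y) => //.
  by apply/funext => v; exact: diag_rep_lin.
- by move=> _ _ [x _ <-] [y _ <-]; exists (x * y); rewrite ?diag_rep_mul.
- move=> _ T' [x _ <-] _ adj; exists (star x) => //.
  exact: adjoint_unique (diag_rep_star x) adj.
- by move=> T L RT _; exact: range_diag_rep_closed.
Qed.

Lemma diag_rep_star_iso : star_iso_onto (cstar_habiro R) diag_rep.
Proof.
split; [exact: diag_rep_lin | exact: diag_rep_mul | exact: diag_rep_star |
  exact: diag_rep_inj | exact: range_diag_rep].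
Qed.

End Representation.

Theorem proposition2p14 (R : realType) (A : cstarAlgType R) (e : QZ -> A)
    (groupA : is_group_cstar e)
    (rho : {additive QZ -> QZ}) (rho_aut : bijective rho) :
  exists! phi : A -> ell2 R -> ell2 R,
    star_iso_onto (cstar_habiro R) phi /\
    forall r : QZ, phi (e r) = E_op (embQZ R rho r) habiro_q.
Proof.
have [chi chiP] := exists_characters groupA rho.
have chi_morph n : star_morphism (chi n) by case: (chiP n).
have chi_gen n r : chi n (e r) = embQZ R rho r ^+ n.+1 by case: (chiP n).
have iso := diag_rep_star_iso groupA rho rho_aut chi chi_morph chi_gen.
have genE := diag_rep_gen rho chi chi_gen.
exists (diag_rep chi); split; first by split.
move=> psi [psi_iso psi_gen].
have e0 := urep0 (gcstar_rep groupA).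
have [|g gm gE] := star_iso_onto_factor _ _ _ iso psi_iso.
  by rewrite -e0 psi_gen genE.
(* The endomorphism [g] fixes the generators, so it is the identity. *)
have [f [_ funiq]] := gcstar_univ groupA (gcstar_rep groupA).
have fid : f = id by apply: funiq; split=> //; split.
have fg : f = g.
  apply: funiq; split=> // r; apply: (siso_inj iso).
  by rewrite gE psi_gen genE.
by apply/funext => x; rewrite -gE -fg fid.
Qed.
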